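(* Let $d \geq 1$ be an integer and, for each integer $m \geq 1$, let $\mathcal{S}(m) = \{1,2,\ldots,m\}^d$. Let $w$ be a function assigning a finite positive weight $w(v)$ to each point $v$ of $\mathcal{S}(m)$ (for all $m$) such that \[ 1 = \inf_m \min_{v \in \mathcal{S}(m)} w(v) \leq \sup_m \max_{v \in \mathcal{S}(m)} w(v) =: \beta < \infty. \] Fix $0<\epsilon<1$, and let $b_m$ be the minimum size of an $\epsilon$-representative code of $\mathcal{S}(m)$. Then \[ m^d (1-\epsilon) \leq b_m \leq m^d\left(1 - \frac{\epsilon}{\beta}\right) + 1 \] for every $m \geq 1$. Suppose moreover that the weight function satisfies the following monotonicity relation: whenever $u$ and $v$ are points differing only in the $i$-th entry and $u_i > v_i$, then $w(u) \leq w(v)$. Then \[ \frac{b_m}{m^d} \longrightarrow \lambda \quad \text{as } m \to \infty, \] for some constant $\lambda$ with $1-\epsilon \leq \lambda \leq 1 - \frac{\epsilon}{\beta}$.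
   Context: For $\mathcal{U} \subseteq \mathcal{S}(m)$, $w(\mathcal{U}) = \sum_{v \in \mathcal{U}} w(v)$, and $\#\mathcal{U}$ denotes the number of points of $\mathcal{U}$. A set $\mathcal{B} \subseteq \mathcal{S}(m)$ is an $\epsilon$-representative code of $\mathcal{S}(m)$ if $\mathcal{B} \cap \mathcal{U} \neq \emptyset$ for every set $\mathcal{U} \subseteq \mathcal{S}(m)$ with $w(\mathcal{U}) \geq \epsilon \cdot m^d$. *)

(* Defs.v *)
From HB Require Import structures.
From mathcomp Require Import all_boot all_order all_algebra finmap.
From mathcomp Require Import all_classical all_reals all_analysis.

Set Implicit Arguments.
Unset Strict Implicit.
Unset Printing Implicit Defensive.

Import Order.TTheory GRing.Theory Num.Theory.
Import numFieldNormedType.Exports.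
Local Open Scope fset_scope.
Local Open Scope ring_scope.

Notation npoint d := {ffun 'I_d -> nat}.

(* The grid {1, ..., m}^d; see [in_grid]. *)
Definition grid (d m : nat) : {fset npoint d} :=
  [fset ([ffun i => (u i).+1] : npoint d)
  | u : {ffun 'I_d -> 'I_m} in {: {ffun 'I_d -> 'I_m}}].

Lemma in_grid d m (v : npoint d) :
  (v \in grid d m) = [forall i, (1 <= v i <= m)%N].
Proof.
apply/imfsetP/forallP => [[u _ ->] i|Hv]; first by rewrite ffunE /= ltn_ord.
have Hlt i : ((v i).-1 < m)%N by have /andP[] := Hv i; case: (v i).
exists [ffun i => Ordinal (Hlt i)] => //; apply/ffunP => i.
by rewrite !ffunE /= prednK //; have /andP[] := Hv i.
Qed.

(* Weight functions are total on nat^d; only their values on the grids, i.e.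
   at points with positive entries, are ever used. *)
Definition weight (R : realType) d (w : npoint d -> R) (U : {fset npoint d}) : R :=
  \sum_(v <- U) w v.

Definition representative_code (R : realType) d (w : npoint d -> R) (eps : R)
    (m : nat) (B : {fset npoint d}) : Prop :=
  B `<=` grid d m /\
  forall U : {fset npoint d}, U `<=` grid d m ->
    eps * m%:R ^+ d <= weight w U -> B `&` U != fset0.

(* The initial value of the minimum is the size of the whole grid, which is
   itself a representative code as soon as eps > 0 and m > 0; see
   [min_code_sizeP]. *)
Definition min_code_size (R : realType) d (w : npoint d -> R) (eps : R)
    (m : nat) : nat :=
  \big[minn/#|` grid d m|]_(B <- fpowerset (grid d m)
                             | `[< representative_code w eps m B >]) #|` B|.

Lemma min_code_sizeP (R : realType) d (w : npoint d -> R) (eps : R) (m : nat) :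
  0 < eps -> (0 < m)%N ->
  (exists2 B, representative_code w eps m B & #|` B| = min_code_size w eps m) /\
  (forall B, representative_code w eps m B ->
     (min_code_size w eps m <= #|` B|)%N).
Proof.
move=> eps0 m0; have rep_grid : representative_code w eps m (grid d m).
  split=> [|U UG wU]; first exact: fsubset_refl.
  rewrite (fsetIidPr UG); apply/eqP => U0; move: wU.
  rewrite U0 /weight big_seq_fset0 leNgt mulr_gt0 // exprn_gt0 //.
  by rewrite ltr0n.
split=> [|B rB].
  rewrite /min_code_size.
  apply: (big_ind (fun n => exists2 B, representative_code w eps m B
                             & #|` B| = n)); first by exists (grid d m).
  - move=> x y [A rA Ax] [B rB By].
    by case: (leqP x y) => xy; [exists A | exists B].
  - by move=> B /asboolP rB; exists B.
have BP : B \in fpowerset (grid d m) by rewrite fpowersetE; case: rB.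
rewrite /min_code_size; move: BP.
rewrite -[B \in _]/(B \in enum_fset _).
elim: (enum_fset _) => [//|C s IHs]; rewrite inE big_cons.
case/predU1P => [<-|/IHs le_s]; first by rewrite asboolT // geq_minl.
by case: ifP => // _; rewrite geq_min le_s orbT.
Qed.

Definition nonincreasing_weight (R : realType) d (w : npoint d -> R) : Prop :=
  forall (m : nat) (u v : npoint d) (i : 'I_d),
    u \in grid d m -> v \in grid d m ->
    (forall j, j != i -> u j = v j) -> (v i < u i)%N -> w u <= w v.

(* Main.v *)
(** A set is a representative code exactly when its complement weighs less than
    [eps * m ^ d], so a code of minimum size is the complement of a largest set
    below that weight, and bounds on the weights become bounds on [b_m].
    For monotone weights, a point [p] with [w p < c] for some [c] close to the
    infimum [1] dominates the weights of all points above it, and these make up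
    all of the grid but a proportion tending to [0]. Hence [beta] can be replaced
    by any [c > 1] asymptotically, and the limit is [1 - eps]. *)
Require Import Defs.
From mathcomp Require Import all_boot all_order all_algebra finmap.
From mathcomp Require Import all_classical all_reals all_analysis.
From mathcomp Require Import lra.

Set Implicit Arguments.
Unset Strict Implicit.
Unset Printing Implicit Defensive.

Import Order.TTheory GRing.Theory Num.Theory.
Import numFieldNormedType.Exports.
Local Open Scope classical_set_scope.
Local Open Scope ring_scope.

(** * Finite sets and rounding *)

Lemma card_grid d m : #|` grid d m| = (m ^ d)%N.
Proof.
rewrite card_imfset /=; first by rewrite -cardE card_ffun !card_ord.
move=> u v /ffunP uv; apply/ffunP => i; apply/val_inj.
by have := uv i; rewrite !ffunE => -[].
Qed.

Lemma ex_fsubset_card (K : choiceType) (V : {fset K}) (k : nat) :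
  (k <= #|` V|)%N -> exists2 U : {fset K}, (U `<=` V)%fset & #|` U| = k.
Proof.
move=> kV; exists [fset x in take k V]%fset.
  by apply/fsubsetP => x; rewrite inE /= => /mem_take.
rewrite card_fseq undup_id ?take_uniq ?fset_uniq // size_take_min.
exact/minn_idPl.
Qed.

(** With [x = eps * m ^ d / c], strictness on the left makes [k] points of weight at most [c] weigh
    strictly less than [eps * m ^ d]. *)
Lemma ex_nat_ceil (R : realType) (x : R) :
  0 < x -> exists k : nat, k%:R < x <= k.+1%:R.
Proof.
move=> x0.
have [|n xn nmin] := ex_minnP (P := fun n : nat => x <= n%:R).
  by exists (Num.truncn x).+1; rewrite ltW // truncnS_gt.
case: n => [|k] in xn nmin *; first by have := lt_le_trans x0 xn; rewrite ltxx.
by exists k; rewrite xn andbT ltNge; apply/negP => /nmin; rewrite ltnn.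
Qed.

(** * Codes in a fixed grid *)

Section Codes.
Variables (R : realType) (d : nat) (w : npoint d -> R) (eps : R) (m : nat).
Hypotheses (w_pos : forall v, v \in grid d m -> 0 < w v).
Hypotheses (eps_gt0 : 0 < eps) (m_gt0 : (0 < m)%N).

Lemma weight_le (U V : {fset npoint d}) :
  (U `<=` V)%fset -> (V `<=` grid d m)%fset -> weight w U <= weight w V.
Proof.
move=> UV Vm; rewrite /weight (big_fsetID _ (mem U) V) /=.
rewrite (_ : [fset x | x in V & x \in U]%fset = U).
  rewrite lerDl big_seq sumr_ge0 // => v; rewrite !inE => /andP[vV _].
  exact/ltW/w_pos/(fsubsetP Vm).
apply/fsetP => v; rewrite !inE /=; case: (boolP (v \in U)) => vU.
  by rewrite (fsubsetP UV _ vU).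
by rewrite andbF.
Qed.

(** A set missed by the complement of [U] lies inside [U], so by positivity of the weights it is no
    heavier than [U]; conversely, [U] itself is missed. *)
Lemma representative_codeC (U : {fset npoint d}) : (U `<=` grid d m)%fset ->
  representative_code w eps m (grid d m `\` U)%fset <->
  weight w U < eps * m%:R ^+ d.
Proof.
move=> Um; split=> [[_ rep]|wU].
  rewrite ltNge; apply/negP => /(rep _ Um)/eqP; apply.
  by apply/fsetP => v; rewrite !inE; case: (v \in U); rewrite ?andbF.
split=> [|V Vm wV]; first exact: fsubsetDl.
apply/negP => /eqP UV0; have VU : (V `<=` U)%fset.
  apply/fsubsetP => v vV; apply/negPn/negP => vU.
  have := in_fset0 v; rewrite -UV0 !inE vU vV (fsubsetP Vm) //.
have := lt_le_trans (le_lt_trans (weight_le VU Um) wU) wV.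
by rewrite ltxx.
Qed.

(** The complement of a minimum code weighs less than [eps * m ^ d], and at least its number of
    points. *)
Lemma min_code_size_ge : (forall v, v \in grid d m -> 1 <= w v) ->
  m%:R ^+ d * (1 - eps) <= (min_code_size w eps m)%:R.
Proof.
move=> w1; have [[B repB <-] _] := min_code_sizeP w eps_gt0 m_gt0.
have Bm : (B `<=` grid d m)%fset by case: repB.
have Cm : (grid d m `\` B `<=` grid d m)%fset by exact: fsubsetDl.
have : weight w (grid d m `\` B)%fset < eps * m%:R ^+ d.
  apply/(representative_codeC Cm).
  by rewrite fsetDK.
have : #|` grid d m `\` B|%fset%:R <= weight w (grid d m `\` B)%fset.
  rewrite -sum1_size natr_sum /weight [leRHS]big_seq [leLHS]big_seq.
  by apply: ler_sum => v /(fsubsetP Cm)/w1.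
rewrite cardfsDS // natrB ?fsubset_leq_card // card_grid natrX.
by lra.
Qed.

(** Removing from the grid as many points of [V] as are sure to weigh less than [eps * m ^ d] leaves
    a code; the [+ 1] is the rounding loss. [V] is the whole grid with [c = beta] for the bound at
    every [m], and a translated subgrid with [c] near 1 for the limit. *)
Lemma min_code_size_le (c : R) (V : {fset npoint d}) : 0 < c ->
  (V `<=` grid d m)%fset -> (forall v, v \in V -> w v <= c) ->
  eps * m%:R ^+ d / c <= #|` V|%:R ->
  (min_code_size w eps m)%:R <= m%:R ^+ d * (1 - eps / c) + 1.
Proof.
move=> c0 Vm wc epsV.
have [|k /andP[k_lt k_ge]] := @ex_nat_ceil R (eps * m%:R ^+ d / c).
  by rewrite divr_gt0 // mulr_gt0 // exprn_gt0 // ltr0n.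
have kV : (k <= #|` V|)%N.
  by rewrite -(ler_nat R) ltW // (lt_le_trans k_lt).
have [U UV Uk] := ex_fsubset_card kV.
have Um := fsubset_trans UV Vm.
have repU : representative_code w eps m (grid d m `\` U)%fset.
  apply/(representative_codeC Um).
  rewrite ltr_pdivlMr // in k_lt; apply: le_lt_trans k_lt.
  rewrite -Uk -sum1_size natr_sum mulr_suml /weight [leRHS]big_seq [leLHS]big_seq.
  by apply: ler_sum => v vU; rewrite mul1r wc // (fsubsetP UV).
have [_ /(_ _ repU)] := min_code_sizeP w eps_gt0 m_gt0.
rewrite -(ler_nat R) cardfsDS // natrB ?fsubset_leq_card // card_grid natrX Uk.
rewrite -natr1 in k_ge.
by move: k_ge; lra.
Qed.

End Codes.

(** * Monotone weights and large grids *)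

Lemma weight_mono (R : realType) (d m : nat) (w : npoint d -> R)
    (p u : npoint d) : nonincreasing_weight w ->
  p \in grid d m -> u \in grid d m -> (forall i, (p i <= u i)%N) -> w u <= w p.
Proof.
move=> wmono pm um pu.
(* Move from [p] to [u] by changing one coordinate at a time. *)
pose h k : npoint d := [ffun i => if (val i < k)%N then u i else p i].
have hm k : h k \in grid d m.
  rewrite in_grid; apply/forallP => i; rewrite ffunE.
  by move: pm um; rewrite !in_grid => /forallP pm /forallP um; case: ifP.
have hw k : (k <= d)%N -> w (h k) <= w p.
  elim: k => [_|k IH kd].
    by rewrite (_ : h 0 = p) //; apply/ffunP => i; rewrite ffunE.
  apply: le_trans (IH (ltnW kd)).
  have h_eq j : j != Ordinal kd -> h k.+1 j = h k j.
    move=> /eqP jk; rewrite !ffunE ltnS leq_eqVlt; case: eqP => //= jk'.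
    by case: jk; apply/val_inj.
  have := pu (Ordinal kd); rewrite leq_eqVlt => /orP[/eqP puk|puk].
    rewrite (_ : h k.+1 = h k) //; apply/ffunP => j.
    case: (eqVneq j (Ordinal kd)) => [->|/h_eq//].
    by rewrite !ffunE /= ltnSn ltnn puk.
  apply: (wmono m _ _ (Ordinal kd)) => //.
  by rewrite !ffunE /= ltnSn ltnn.
by rewrite (_ : u = h d) ?hw //; apply/ffunP => i; rewrite ffunE ltn_ord.
Qed.

(** For large [m] this is the proportion of the grid filled by a translate of [grid d (m - P)]. *)
Lemma ratio_subn_pow_cvg (R : realType) (P d : nat) :
  (fun m : nat => (m - P)%N%:R ^+ d / m%:R ^+ d : R) @ \oo --> (1 : R).
Proof.
have cvgP : (fun m : nat => 1 - P%:R * harmonic m : R) @ \oo --> (1 : R).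
  rewrite -[X in _ --> X](subr0 (1 : R)) -[X in _ - X](mulr0 (P%:R : R)).
  by apply: cvgB; [exact: cvg_cst|apply: cvgMr; exact: cvg_harmonic].
(* [harmonic m] is the inverse of [m + 1], hence the shift of the index. *)
rewrite -cvg_shiftS.
have : (fun m : nat => (1 - P%:R * harmonic m) ^+ d : R) @ \oo --> (1 : R).
  rewrite -[X in _ --> X](expr1n R d).
  exact: (continuous_cvg _ (@exprn_continuous R d 1) cvgP).
apply: cvg_trans; apply: near_eq_cvg; near=> m.
rewrite /= -expr_div_n; congr (_ ^+ _).
rewrite natrB; last by apply: leqW; near: m; exact: nbhs_infty_ge.
by rewrite mulrBl divff.
Unshelve. all: by end_near. Qed.

Lemma ereal_inf_grid_le (R : realType) (d m : nat) (w : npoint d -> R)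
    (a : \bar R) (v : npoint d) :
  ereal_inf [set \big[mine/+oo%E]_(v <- grid d m) (w v)%:E
            | m in [set m : nat | (1 <= m)%N]] = a ->
  (1 <= m)%N -> v \in grid d m -> (a <= (w v)%:E)%E.
Proof.
move=> <- m1 vm; apply: (@le_trans _ _ (\big[mine/+oo%E]_(u <- grid d m) (w u)%:E)%E).
  by apply: ereal_inf_lbound; exists m.
exact: ge_bigmin_seq.
Qed.

Lemma ereal_sup_grid_ge (R : realType) (d m : nat) (w : npoint d -> R)
    (b : \bar R) (v : npoint d) :
  ereal_sup [set \big[maxe/-oo%E]_(v <- grid d m) (w v)%:E
            | m in [set m : nat | (1 <= m)%N]] = b ->
  (1 <= m)%N -> v \in grid d m -> ((w v)%:E <= b)%E.
Proof.
move=> <- m1 vm; apply: (@le_trans _ _ (\big[maxe/-oo%E]_(u <- grid d m) (w u)%:E)%E).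
  exact: le_bigmax_seq.
by apply: ereal_sup_ubound; exists m.
Qed.

Lemma ereal_inf_grid_lt (R : realType) (d : nat) (w : npoint d -> R) (c : R) :
  (ereal_inf [set \big[mine/+oo%E]_(v <- grid d m) (w v)%:E
             | m in [set m : nat | (1 <= m)%N]] < c%:E)%E ->
  exists m : nat, exists2 p, p \in grid d m & w p < c.
Proof.
move=> /ereal_inf_lt[_ [m m1 <-] lt_c]; exists m; apply: contrapT => nex.
move: lt_c; rewrite ltNge => /negP; apply; rewrite big_seq.
apply: le_bigmin => [|v vm]; first exact: leey.
by rewrite lee_fin leNgt; apply/negP => wv; apply: nex; exists v.
Qed.

(** The translate of [grid d (m - P)] by [P] lies above [p] in every coordinate, so its weights are
    below [c]; its proportion tends to [1 > eps], so it eventually has the [eps * m ^ d / c] points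
    required. *)
Lemma min_code_size_near_le (R : realType) (d : nat) (w : npoint d -> R)
    (eps c : R) :
  (forall m v, v \in grid d m -> 0 < w v) -> nonincreasing_weight w ->
  (exists m : nat, exists2 p, p \in grid d m & w p < c) ->
  0 < eps < 1 -> 1 <= c ->
  \forall m \near \oo, (min_code_size w eps m)%:R
    <= m%:R ^+ d * (1 - eps / c) + 1.
Proof.
move=> wpos wmono [P [p pP wpc]] /andP[eps0 eps1] c1.
have c0 : 0 < c by exact: lt_le_trans c1.
near=> m.
have m0 : (0 < m)%N by near: m; exact: nbhs_infty_ge.
have Pm : (P <= m)%N by near: m; exact: nbhs_infty_ge.
have md0 : 0 < m%:R ^+ d :> R by rewrite exprn_gt0 // ltr0n.
pose shift (v : npoint d) : npoint d := [ffun i => (v i + P)%N].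
pose V := [fset shift v | v in grid d (m - P)]%fset.
have Vm : (V `<=` grid d m)%fset.
  apply/fsubsetP => _ /imfsetP[/= v + ->]; rewrite !in_grid => /forallP vm.
  apply/forallP => i; rewrite ffunE; have /andP[v1 vmP] := vm i.
  by rewrite (leq_trans v1) ?leq_addr //= addnC -leq_subRL.
have cardV : #|` V| = ((m - P) ^ d)%N.
  rewrite -card_grid card_imfset //= => u v /ffunP uv; apply/ffunP => i.
  by have := uv i; rewrite !ffunE => /addIn.
apply: (min_code_size_le (wpos m) eps0 m0 c0 Vm).
- move=> v vV; apply: le_trans (ltW wpc).
  apply: (weight_mono (m := m)) => //; last 2 first.
  + exact: (fsubsetP Vm).
  + move=> i; move: vV => /imfsetP[/= u _ ->]; rewrite ffunE.
    move: pP; rewrite in_grid => /forallP/(_ i)/andP[_ pP].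
    by rewrite (leq_trans pP) // leq_addl.
  + move: pP; rewrite !in_grid => /forallP pP; apply/forallP => i.
    by have /andP[-> /leq_trans ->] := pP i.
(* Since [1 <= c], it suffices that the proportion of [V] be at least [eps]. *)
- rewrite cardV natrX; apply: (@le_trans _ _ (eps * m%:R ^+ d)).
    rewrite ler_pdivrMr // ler_peMr // mulr_ge0 // ?ltW //.
  rewrite -ler_pdivlMr //; near: m.
  by apply: (cvgr_ge 1); [exact: ratio_subn_pow_cvg|].
Unshelve. all: by end_near. Qed.

Theorem theorem2 (R : realType) (d : nat) (hd : (1 <= d)%N)
    (w : npoint d -> R) (beta eps : R)
    (hpos : forall (m : nat) (v : npoint d), v \in grid d m -> 0 < w v)
    (hinf : ereal_inf [set \big[mine/+oo%E]_(v <- grid d m) (w v)%:E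
                      | m in [set m : nat | (1 <= m)%N]] = 1%:E)
    (hsup : ereal_sup [set \big[maxe/-oo%E]_(v <- grid d m) (w v)%:E
                      | m in [set m : nat | (1 <= m)%N]] = beta%:E)
    (heps : 0 < eps < 1) :
  (forall m : nat, (1 <= m)%N ->
     m%:R ^+ d * (1 - eps) <= (min_code_size w eps m)%:R
       <= m%:R ^+ d * (1 - eps / beta) + 1) /\
  (nonincreasing_weight w ->
     exists2 lambda : R, 1 - eps <= lambda <= 1 - eps / beta
       & (fun m : nat => (min_code_size w eps m)%:R / m%:R ^+ d : R) @ \oo
           --> lambda).
Proof.
have /andP[eps0 eps1] := heps.
have w_ge1 m v : v \in grid d m -> 1 <= w v.
  (* [hinf] says nothing about [m = 0], but that grid is empty because [d] is positive. *)
  case: m => [|m] vm.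
    move: vm; rewrite in_grid => /forallP/(_ (Ordinal hd)).
    by rewrite leqn0; case: (v _).
  by have := ereal_inf_grid_le hinf (ltn0Sn m) vm; rewrite lee_fin.
have w_le m v : (1 <= m)%N -> v \in grid d m -> w v <= beta.
  move=> m1 vm.
  by have := ereal_sup_grid_ge hsup m1 vm; rewrite lee_fin.
have beta1 : 1 <= beta.
  have v1 : ([ffun=> 1%N] : npoint d) \in grid d 1.
    by rewrite in_grid; apply/forallP => i; rewrite ffunE.
  by rewrite (le_trans (w_ge1 _ _ v1)) ?(w_le 1%N).
have beta0 : 0 < beta by exact: lt_le_trans beta1.
have lower m : (1 <= m)%N ->
    m%:R ^+ d * (1 - eps) <= (min_code_size w eps m)%:R.
  by move=> m1; apply: min_code_size_ge => //; [exact: hpos|exact: w_ge1].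
split=> [m m1|wmono].
  rewrite lower //=.
  apply: (min_code_size_le (hpos m) eps0 m1 beta0 (fsubset_refl _)).
  - by move=> v; exact: w_le.
  - rewrite card_grid natrX ler_pdivrMr // mulrC ler_wpM2l ?exprn_ge0 //.
    exact: le_trans (ltW eps1) beta1.
(* The lower bound is already [1 - eps], and the upper one tends to it as [c] decreases to 1. *)
exists (1 - eps).
  by rewrite lexx lerD2l lerN2 ler_pdivrMr // ler_peMr // ltW.
apply/cvgrPdist_le => /= e e0.
(* Half of [e] pays for replacing [eps / c] by [eps], the other half for the [+ 1] divided by
   [m ^ d]. *)
have e2 : 0 < e / 2 by rewrite divr_gt0.
pose c := 1 + e / 2.
have c1 : 1 < c by rewrite ltrDl.
have inf_lt : exists m : nat, exists2 p, p \in grid d m & w p < c.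
  by apply: ereal_inf_grid_lt; rewrite hinf lte_fin.
near=> m.
have m1 : (1 <= m)%N by near: m; exact: nbhs_infty_ge.
have md0 : 0 < m%:R ^+ d :> R by rewrite exprn_gt0 // ltr0n.
rewrite distrC ger0_norm; last by rewrite subr_ge0 ler_pdivlMr // mulrC lower.
rewrite lerBlDl ler_pdivrMr // mulrC.
have upper : (min_code_size w eps m)%:R <= m%:R ^+ d * (1 - eps / c) + 1.
  by near: m; exact: min_code_size_near_le hpos wmono inf_lt heps (ltW c1).
(* Here [1 - 1 / c <= c - 1 = e / 2], and [eps < 1]. *)
have epsc : eps - eps / c <= e / 2.
  rewrite -{1}(mulr1 eps) -mulrBr -(mul1r (e / 2)); apply: ler_pM.
  - exact: ltW.
  - by rewrite subr_ge0 invf_le1 ?ltW // (lt_trans ltr01).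
  - exact: ltW.
  - have c0 := lt_trans ltr01 c1.
    rewrite lerBlDl -lerBlDr -(ler_pM2r c0) mulVf ?gt_eqF // /c.
    by nra.
(* As [d] is positive, [m ^ d >= m], which is eventually at least [2 / e]. *)
have md_e : 1 <= m%:R ^+ d * (e / 2).
  rewrite -ler_pdivrMr // mul1r.
  apply: (@le_trans _ _ m%:R); first by near: m; exact: nbhs_infty_ger.
  by rewrite -natrX ler_nat -{1}(expn1 m) leq_pexp2l.
apply: (le_trans upper).
apply: (@le_trans _ _ (m%:R ^+ d * (1 - eps / c) + m%:R ^+ d * (e / 2))).
  by rewrite lerD2l.
rewrite -mulrDr ler_pM2l //.
by lra.
Unshelve. all: by end_near. Qed.
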